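(* Let $(V,\top)$ and $(V_1,\top_1)$ be two locality vector spaces and let $\iota_1:V_1\to V$ be an injective locality linear map. Then $(V/\iota_1(V_1),\overline\top)$ is a locality vector space if, and only if, there are a locality vector space $(V_2,\top_2)$ and a map $\pi_2:V\to V_2$ such that $\top_2$ is the final locality relation for $\pi_2$, and $0\to(V_1,\top_1)\overset{\iota_1}{\to}(V,\top)\overset{\pi_2}{\to}(V_2,\top_2)\to0$ is a locality short exact sequence.
   Context: The ground field is $\mathbb{R}$ or $\mathbb{C}$. A locality vector space is a vector space $V$ with a symmetric relation $\top\subset V\times V$ containing $(0,0)$ such that for every subset $U\subset V$ the polar set $U^\top=\{x\in V: x\top u\ \forall u\in U\}$ is a linear subspace. A locality map sends related pairs to related pairs; a locality linear map is a linear locality map. The quotient locality $\overline\top$ on a quotient $V/W$ is: $[u]\,\overline\top\,[v]$ iff there exist $u'\in[u]$, $v'\in[v]$ with $u'\top v'$. The final locality relation on a set $X$ for a map $f:(X_1,\top_1)\to X$ is the smallest (for inclusion) symmetric relation on $X$ making $f$ a locality map. A locality short exact sequence is a sequence $0\to(V_1,\top_1)\overset{f_1}{\to}(V_2,\top_2)\overset{f_2}{\to}(V_3,\top_3)\to0$ such that the $(V_i,\top_i)$ are locality vector spaces, $f_1,f_2$ are locality maps, and $0\to V_1\overset{f_1}{\to}V_2\overset{f_2}{\to}V_3\to0$ is a short exact sequence of vector spaces. *)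

(* Defs.v *)
From HB Require Import structures.
From mathcomp Require Import all_boot all_order all_algebra.
From mathcomp Require Import all_classical reals complex.

Set Implicit Arguments.
Unset Strict Implicit.
Unset Printing Implicit Defensive.

Import GRing.Theory.
Local Open Scope ring_scope.
Local Open Scope classical_set_scope.
Local Open Scope quotient_scope.

Inductive ground_field := Real_field | Complex_field.

Definition scalars (R : realType) (k : ground_field) : fieldType :=
  match k with
  | Real_field => R
  | Complex_field => complex R
  end.

(* [Quotient.quot] takes a [zmodClosed] predicate and only provides the additive
   group structure of V/W.  A [submodClosed] predicate is not canonically
   [zmodClosed], hence the alias below; the scalar multiplication of V/W is
   added afterwards. *)
Section SubmodZmod.
Variables (K : pzRingType) (V : lmodType K) (W : submodClosed V).

Definition submod_pred : {pred V} := [in W].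

Fact submod_pred_zmod : zmod_closed submod_pred.
Proof. exact: GRing.submod_closedB (submodClosedP W). Qed.

HB.instance Definition _ :=
  GRing.isZmodClosed.Build V submod_pred submod_pred_zmod.

Definition lmod_quot : Type := Quotient.quot submod_pred.

End SubmodZmod.

Section LmodQuotient.
Variables (K : pzRingType) (V : lmodType K) (W : submodClosed V).
Local Notation Q := (lmod_quot W).

HB.instance Definition _ := GRing.Zmodule.on Q.
HB.instance Definition _ := Quotient.on Q.

Definition qscale (a : K) (x : Q) : Q := \pi_Q (a *: repr x).

Lemma eq_quotP (u v : V) : (\pi_Q u = \pi_Q v) <-> (u - v \in W).
Proof.
rewrite (Quotient.idealrBE (submod_pred W) u v).
by split => [->|/eqP].
Qed.

Lemma pi_qscale a (u : V) : qscale a (\pi_Q u) = \pi_Q (a *: u).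
Proof.
apply/eq_quotP; rewrite -scalerBr; apply: rpredZ.
by apply/eq_quotP; rewrite reprK.
Qed.

Lemma pi_quotD (u v : V) : \pi_Q (u + v) = \pi_Q u + \pi_Q v.
Proof. exact: (raddfD (\pi_(Quotient.quot (submod_pred W)))). Qed.

Fact pi_surj (x : Q) : exists u, x = \pi_Q u.
Proof. by exists (repr x); rewrite reprK. Qed.

Fact qscaleA a b (x : Q) : qscale a (qscale b x) = qscale (a * b) x.
Proof. by have [u ->] := pi_surj x; rewrite !pi_qscale scalerA. Qed.

Fact qscale1 : left_id 1 qscale.
Proof. by move=> x; have [u ->] := pi_surj x; rewrite pi_qscale scale1r. Qed.

Fact qscaleDr : right_distributive qscale +%R.
Proof.
move=> a x y; have [u ->] := pi_surj x; have [v ->] := pi_surj y.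
by rewrite -pi_quotD !pi_qscale scalerDr pi_quotD.
Qed.

Fact qscaleDl (x : Q) : {morph qscale^~ x : a b / a + b}.
Proof.
by move=> a b; have [u ->] := pi_surj x; rewrite !pi_qscale scalerDl pi_quotD.
Qed.

HB.instance Definition _ :=
  GRing.Zmodule_isLmodule.Build K Q qscaleA qscale1 qscaleDr qscaleDl.

Fact pi_quot_linear : linear (\pi_Q : V -> Q).
Proof. by move=> a u v; rewrite pi_quotD -pi_qscale. Qed.

End LmodQuotient.

Section LinearImage.
Variables (K : pzRingType) (V1 V : lmodType K) (f : {linear V1 -> V}).

Definition linear_range : {pred V} := [in range f].

Fact linear_range_submod : submod_closed linear_range.
Proof.
split; first by apply/mem_set; exists 0 => //; rewrite linear0.
move=> a u v /set_mem[x _ <-] /set_mem[y _ <-].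
by apply/mem_set; exists (a *: x + y) => //; rewrite linearP.
Qed.

HB.instance Definition _ :=
  GRing.isSubmodClosed.Build K V linear_range linear_range_submod.

End LinearImage.

Definition symmetric_relation (X : Type) (T : set (X * X)) : Prop :=
  forall x y, T (x, y) -> T (y, x).

Definition polar (X : Type) (T : set (X * X)) (U : set X) : set X :=
  [set x | forall u, U u -> T (x, u)].

Definition locality_vector_space (K : pzRingType) (V : lmodType K)
    (T : set (V * V)) : Prop :=
  [/\ symmetric_relation T, T (0, 0) &
      forall U : set V, submod_closed [in polar T U]].

Definition locality_map (X Y : Type) (TX : set (X * X)) (TY : set (Y * Y))
    (f : X -> Y) : Prop :=
  forall x y, TX (x, y) -> TY (f x, f y).

Definition final_locality (X1 X : Type) (T1 : set (X1 * X1)) (f : X1 -> X)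
    (T : set (X * X)) : Prop :=
  [/\ symmetric_relation T, locality_map T1 T f &
      forall S : set (X * X),
        symmetric_relation S -> locality_map T1 S f -> T `<=` S].

Definition quotient_locality (K : pzRingType) (V : lmodType K)
    (W : submodClosed V) (T : set (V * V)) :
    set (lmod_quot W * lmod_quot W) :=
  [set xy | exists u v : V,
    [/\ \pi_(lmod_quot W) u = xy.1, \pi_(lmod_quot W) v = xy.2 & T (u, v)]].

Arguments quotient_locality {K V} W T.

Definition short_exact (K : pzRingType) (V1 V2 V3 : lmodType K)
    (f1 : V1 -> V2) (f2 : V2 -> V3) : Prop :=
  [/\ linear f1, linear f2, injective f1,
      range f1 = f2 @^-1` [set 0] & range f2 = [set: V3]].

Definition locality_short_exact (K : pzRingType) (V1 V2 V3 : lmodType K)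
    (T1 : set (V1 * V1)) (T2 : set (V2 * V2)) (T3 : set (V3 * V3))
    (f1 : V1 -> V2) (f2 : V2 -> V3) : Prop :=
  [/\ locality_vector_space T1, locality_vector_space T2 &
      locality_vector_space T3] /\
  [/\ locality_map T1 T2 f1, locality_map T2 T3 f2 & short_exact f1 f2].

(* Main.v *)
Require Import Defs.
From HB Require Import structures.
From mathcomp Require Import all_boot all_order all_algebra.
From mathcomp Require Import all_classical reals complex.

(** Both sides speak of the same relation.  The final locality relation for a
    map [f] out of [(X1, T1)], with [T1] symmetric, is the direct image of [T1]
    under [f x f] ([final_localityP]); for the canonical projection onto
    [V / iota1(V1)] this direct image is the quotient locality by definition.
    Hence, if the quotient is a locality vector space, it provides [V2] and
    [pi2] itself.

    Conversely, a surjection [pi2] with kernel [iota1(V1)] induces an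
    isomorphism from [V / iota1(V1)] to [V2], under which the quotient locality
    corresponds to the final locality relation [T2]
    ([quotient_locality_pullback]).  Being a locality vector space passes from
    [T2] to its inverse image under any linear map
    ([locality_vector_space_pullback]), because polar sets of the inverse image
    are preimages of polar sets. *)

Local Open Scope ring_scope.
Local Open Scope classical_set_scope.
Local Open Scope quotient_scope.

Import GRing.Theory.

(** The direct image inherits symmetry from [T1] and is contained in every
    relation that makes [f] a locality map, so it is the smallest one. *)
Lemma final_localityP {X1 X : Type} {T1 : set (X1 * X1)} {f : X1 -> X}
    {T : set (X * X)} :
  symmetric_relation T1 ->
  final_locality T1 f T <->
  T = [set xy | exists u v, [/\ f u = xy.1, f v = xy.2 & T1 (u, v)]].
Proof.
move=> symT1; set I := [set xy | _].
have symI : symmetric_relation I.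
  move=> x y [u [v [/= fu fv uv]]].
  by exists v, u; split => //; exact: symT1.
have locI : locality_map T1 I f by move=> u v uv; exists u, v.
have minI (S : set (X * X)) : locality_map T1 S f -> I `<=` S.
  by move=> locS [x y] [u [v [/= <- <- uv]]]; exact: locS.
split=> [[symT locT minT]|->].
  by apply/seteqP; split; [exact: minT|exact: minI].
by split=> // S _; exact: minI.
Qed.

(** The polar set of [U] for the inverse image relation is the preimage under
    [f] of the polar set of [f @` U]. *)
Lemma locality_vector_space_pullback {K : pzRingType} {A B : lmodType K}
    {TB : set (B * B)} {f : A -> B} :
  linear f -> locality_vector_space TB ->
  locality_vector_space [set xy | TB (f xy.1, f xy.2)].
Proof.
move=> linf [symTB TB00 polTB].
have f0 : f 0 = 0.
  have := linf (-1) 0 0.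
  by rewrite scaleN1r oppr0 addr0 scaleN1r addNr.
have polE U x : (x \in polar [set xy | TB (f xy.1, f xy.2)] U) =
                (f x \in polar TB (f @` U)).
  apply/idP/idP => /set_mem xU; apply/mem_set.
    by move=> _ [u Uu <-]; exact: xU.
  by move=> u Uu; apply: xU; exists u.
split=> [x y|/=|U]; first exact: symTB.
  by rewrite f0.
have [pol0 polD] := polTB (f @` U).
split=> [|a x y]; first by rewrite polE f0.
by rewrite !polE linf; exact: polD.
Qed.

Section InducedMap.
Context {K : pzRingType} {V V2 : lmodType K} {W : submodClosed V}.
Context {p : V -> V2}.
Hypothesis p_linear : linear p.
Hypothesis p_kernel : forall u, (p u = 0) <-> (u \in W).
Local Notation Q := (lmod_quot W).

Lemma eq_linear_quot (u v : V) : (p u = p v) <-> (\pi_Q u = \pi_Q v).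
Proof.
have pB : p (u - v) = p u - p v.
  by rewrite addrC -scaleN1r p_linear scaleN1r addrC.
rewrite eq_quotP -p_kernel pB.
by split=> [->|/eqP]; [rewrite subrr|rewrite subr_eq0 => /eqP].
Qed.

Definition induced (x : Q) : V2 := p (repr x).

Lemma induced_pi (u : V) : induced (\pi_Q u) = p u.
Proof. by apply/eq_linear_quot; rewrite reprK. Qed.

Lemma induced_linear : linear induced.
Proof.
move=> a x y; rewrite -[x]reprK -[y]reprK -pi_quot_linear !induced_pi.
exact: p_linear.
Qed.

(** The induced map is injective, so that two representatives have the same
    image in [V2] exactly when they have the same class; related
    representatives of two classes are therefore the same thing as related
    preimages of their images. *)
Lemma quotient_locality_pullback {T : set (V * V)} {T2 : set (V2 * V2)} :
  symmetric_relation T -> final_locality T p T2 ->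
  quotient_locality W T = [set xy | T2 (induced xy.1, induced xy.2)].
Proof.
move=> symT /(final_localityP symT) ->.
apply/seteqP; split=> -[x y] [u [v [/= xu yv uv]]]; exists u, v; split=> //=.
- by rewrite -xu induced_pi.
- by rewrite -yv induced_pi.
- by rewrite -[RHS]reprK; apply/eq_linear_quot.
- by rewrite -[RHS]reprK; apply/eq_linear_quot.
Qed.

End InducedMap.

Lemma short_exact_quot {K : pzRingType} {V1 V : lmodType K}
    (f : {linear V1 -> V}) :
  injective f -> short_exact f \pi_(lmod_quot (linear_range f)).
Proof.
move=> f_inj; have pi0 : \pi_(lmod_quot (linear_range f)) 0 = 0.
  by apply/(addrI (\pi_(lmod_quot (linear_range f)) 0)); rewrite -pi_quotD !addr0.
split=> //; [exact: linearP|exact: pi_quot_linear| |].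
- apply/seteqP; split=> u /=.
    by move=> fu; rewrite -pi0; apply/eq_quotP; rewrite subr0; exact/mem_set.
  by rewrite -pi0 => /eq_quotP; rewrite subr0 => /set_mem.
- apply/seteqP; split=> // x _.
  by have [u ->] := pi_surj x; exists u.
Qed.

Theorem proposition5p9 (R : realType) (k : ground_field)
    (V V1 : lmodType (scalars R k))
    (T : set (V * V)) (T1 : set (V1 * V1))
    (hT : locality_vector_space T) (hT1 : locality_vector_space T1)
    (iota1 : {linear V1 -> V})
    (iota1_inj : injective iota1) (iota1_loc : locality_map T1 T iota1) :
  locality_vector_space (quotient_locality (linear_range iota1) T) <->
  exists (V2 : lmodType (scalars R k)) (T2 : set (V2 * V2)) (pi2 : V -> V2),
    final_locality T pi2 T2 /\ locality_short_exact T1 T T2 iota1 pi2.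
Proof.
have [symT _ _] := hT.
split=> [hQ|].
  exists (lmod_quot (linear_range iota1)),
    (quotient_locality (linear_range iota1) T),
    \pi_(lmod_quot (linear_range iota1)).
  split; first exact/(final_localityP symT).
  do 2!split=> //; last exact: short_exact_quot.
  by move=> u v uv; exists u, v.
move=> [V2 [T2 [pi2 [finT2 [[_ _ hT2] [_ _ [_ lin_pi2 _ kerE _]]]]]]].
have ker_pi2 u : (pi2 u = 0) <-> (u \in linear_range iota1).
  have -> : (pi2 u = 0) = range iota1 u by rewrite kerE.
  by split=> [/mem_set|/set_mem].
rewrite (quotient_locality_pullback lin_pi2 ker_pi2 symT finT2).
apply: (locality_vector_space_pullback _ hT2).
exact: induced_linear.
Qed.
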